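(* Let $H$ be a finite set of individuals, let $\mathcal{H}$ be the set of all subsets of $H$, and for $\alpha\in\{A,B\}$ let $f_\alpha:\mathcal{H}\to\{0,1\}$ be an increasing function ($S\supseteq T$ implies $f_\alpha(S)\ge f_\alpha(T)$) with $f_\alpha(\emptyset)=0$ and $f_\alpha(H)=1$. Let $p_h\in[0,1]$ for $h\in H$. For $S\subseteq H$ let $\Pi_3(S)$ be the probability of merger under the $S$-strategy (described in the context). Then $\Pi_3(S)$ is an increasing function of $S$, i.e. $S\supseteq T$ implies $\Pi_3(S)\ge\Pi_3(T)$. In particular, the $H$-strategy maximizes the probability of a merger over all $S$-strategies.
   Context: $A$ and $B$ are two companies whose shareholders are in $H$. A coalition $S\subseteq H$ is winning in company $\alpha$ if $f_\alpha(S)=1$ and losing if $f_\alpha(S)=0$. The merger happens iff the set of individuals who vote yes in $A$ is winning in $A$ and the set of individuals who vote yes in $B$ is winning in $B$. Under the $S$-strategy ($S\subseteq H$), each $h\in S$ is sent one joint ballot, whose return means that $h$ votes yes in both $A$ and $B$ (and if it is not returned, $h$ votes yes in neither); each $h\in H\setminus S$ is sent two separate ballots, the return of one meaning a yes vote in $A$ and the return of the other meaning a yes vote in $B$. Each ballot sent to $h$ is returned with probability $p_h$, independently across individuals and across different ballots sent to the same individual. *)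

(* Defs.v *)
From HB Require Import structures.
From mathcomp Require Import all_boot all_order all_algebra.
From mathcomp Require Import reals.

Set Implicit Arguments.
Unset Strict Implicit.
Unset Printing Implicit Defensive.

Import Order.TTheory GRing.Theory Num.Theory.

Local Open Scope ring_scope.

Inductive company := CompanyA | CompanyB.

Definition bool_of_company (c : company) : bool :=
  if c is CompanyA then true else false.

Definition company_of_bool (b : bool) : company :=
  if b then CompanyA else CompanyB.

Lemma bool_of_companyK : cancel bool_of_company company_of_bool.
Proof. by case. Qed.

HB.instance Definition _ := Finite.copy company (can_type bool_of_companyK).

(* The probability of the event [E] when a random subset [W] of [A] is formed
   by putting each [b] of [A] in [W] with probability [q b], independently. *)
Definition indep_prob (R : realType) (B : finType) (A : {set B}) (q : B -> R)
    (E : pred {set B}) : R :=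
  \sum_(W : {set B} | (W \subset A) && E W)
    (\prod_(b in W) q b * \prod_(b in A :\: W) (1 - q b)).

Section Merger.
Variables (R : realType) (H : finType).

(* [(h, None)] is the joint ballot of [h], and [(h, Some c)] is the separate
   ballot of [h] for company [c]. *)
Definition ballot : finType := (H * option company)%type.

Definition sent_ballots (S : {set H}) : {set ballot} :=
  [set b : ballot | if b.1 \in S then b.2 == None else b.2 != None].

(* [W] is the set of ballots returned under the [S]-strategy. *)
Definition yes_voters (S : {set H}) (W : {set ballot}) (c : company) :
    {set H} :=
  [set h | if h \in S then ((h, None) : ballot) \in W
           else ((h, Some c) : ballot) \in W].

Definition merger (f : company -> {set H} -> bool) (S : {set H})
    (W : {set ballot}) : bool :=
  f CompanyA (yes_voters S W CompanyA) && f CompanyB (yes_voters S W CompanyB).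

Definition Pi3 (f : company -> {set H} -> bool) (p : H -> R) (S : {set H}) : R :=
  indep_prob (sent_ballots S) (fun b : ballot => p b.1) (merger f S).

End Merger.

(* Main.v *)
(* It suffices to move one individual h from separate ballots to a joint one.
   Fix the returned ballots of everybody else, and let V c be the resulting set
   of yes voters in company c. The gain in the conditional probability of merger
   is p_h (1 - p_h) times
     (f_A (h |: V_A) - f_A V_A) * (f_B (h |: V_B) - f_B V_B),
   which is nonnegative because both f_c are increasing. *)
Require Import Defs.
From mathcomp Require Import all_boot all_order all_algebra.
From mathcomp Require Import reals.
From mathcomp Require Import ring lra.

Set Implicit Arguments.
Unset Strict Implicit.
Unset Printing Implicit Defensive.

Import Order.TTheory GRing.Theory Num.Theory.

Local Open Scope ring_scope.

Section IndependentSubset.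
Variables (R : realType) (B : finType).
Implicit Types (A W : {set B}) (q g : B -> R) (b : B).

(** Conditioning on a single ballot turns the indicator of an event into a real-valued function, so
    [indep_prob] is extended to expectations. *)
Definition indep_expect A q (X : {set B} -> R) : R :=
  \sum_(W : {set B} | W \subset A)
    (\prod_(b in W) q b * \prod_(b in A :\: W) (1 - q b)) * X W.

Lemma indep_probE A q (E : pred {set B}) :
  indep_prob A q E = indep_expect A q (fun W => (E W)%:R).
Proof.
rewrite /indep_prob /indep_expect big_mkcondr; apply: eq_bigr => W _.
by case: (E W); rewrite ?mulr1 ?mulr0.
Qed.

Lemma ler_indep_expect A q (X Y : {set B} -> R) :
    (forall b, 0 <= q b <= 1) ->
    (forall W, W \subset A -> X W <= Y W) ->
  indep_expect A q X <= indep_expect A q Y.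
Proof.
move=> q01 leXY; apply: ler_sum => W sWA; apply: ler_wpM2l; last exact: leXY.
apply: mulr_ge0; apply: prodr_ge0 => b _; have /andP[q_ge0 q_le1] := q01 b => //.
by rewrite subr_ge0.
Qed.

(** Condition on whether [b] is drawn: the outcomes containing [b] correspond to the subsets of [A]
    through [W |-> b |: W], and the others are the subsets of [A]. *)
Lemma indep_expectU1 A q (X : {set B} -> R) b : b \notin A ->
  indep_expect (b |: A) q X =
  indep_expect A q (fun W => q b * X (b |: W) + (1 - q b) * X W).
Proof.
move=> bNA; rewrite /indep_expect (bigID (fun W : {set B} => b \in W)) /=.
rewrite (reindex_onto (fun W => b |: W) (fun W => W :\ b)) /=; last first.
  by move=> W /andP[_ bW]; rewrite setD1K.
(* The reindexing condition [(b |: W) :\ b == W] says that [b] is not in [W]. *)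
rewrite (eq_bigl (fun W : {set B} => W \subset A)); last first.
  move=> W; rewrite setU11 andbT; apply/andP/idP => [[sWA /eqP eqW]|sWA].
    by rewrite -eqW subDset.
  by rewrite setUS // setU1K // (contra (subsetP sWA b)).
rewrite [X in _ + X](eq_bigl (fun W : {set B} => W \subset A)); last first.
  by move=> W; rewrite -subsetD1 setU1K.
rewrite -big_split; apply: eq_bigr => W sWA /=.
have bNW : b \notin W by rewrite (contra (subsetP sWA b)).
have -> : (b |: A) :\: (b |: W) = A :\: W.
  apply/setP => x; rewrite !inE; case: eqP => [->|] //=.
  by rewrite (negPf bNA) andbF.
have -> : (b |: A) :\: W = b |: (A :\: W).
  by apply/setP => x; rewrite !inE; case: eqP => [->|] //=; rewrite bNW.
rewrite !big_setU1 //=; last by rewrite inE (negPf bNA) andbF.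
ring.
Qed.

End IndependentSubset.

(** The right side minus the left side is [p * (1 - p) * (a1 - a0) * (b1 - b0)]. Index 1 stands for
    a yes vote of the moved individual, [a] for company A and [b] for company B. *)
Lemma joint_ballot_gain (R : realType) (p : R) (a0 a1 b0 b1 : bool) :
    0 <= p <= 1 -> (a0 <= a1)%N -> (b0 <= b1)%N ->
  p * (p * (a1 && b1)%:R + (1 - p) * (a1 && b0)%:R)
    + (1 - p) * (p * (a0 && b1)%:R + (1 - p) * (a0 && b0)%:R)
  <= p * (a1 && b1)%:R + (1 - p) * (a0 && b0)%:R.
Proof. by case: a0 a1 b0 b1 => -[] [] [] //=; nra. Qed.

(** The ballots of [h] are split off. The remaining set is the same as in [sent_ballotsU1], which
    lets the two strategies be compared outcome by outcome. *)
Lemma sent_ballots_notin (H : finType) (S : {set H}) (h : H) : h \notin S ->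
  sent_ballots S =
  (h, Some CompanyB) |: ((h, Some CompanyA) |: [set b in sent_ballots S | b.1 != h]).
Proof.
move=> hNS; apply/setP => -[k o]; rewrite !inE !xpair_eqE /=.
by case: (eqVneq k h) => [->|]; rewrite ?(negPf hNS) ?andbT //; case: o => [[]|].
Qed.

Lemma sent_ballotsU1 (H : finType) (S : {set H}) (h : H) :
  sent_ballots (h |: S) = (h, None) |: [set b in sent_ballots S | b.1 != h].
Proof.
apply/setP => -[k o]; rewrite !inE !xpair_eqE /=.
by case: (eqVneq k h) => [->|] //=; rewrite ?andbF ?orbF ?andbT.
Qed.

Lemma Pi3_setU1 (R : realType) (H : finType) (f : company -> {set H} -> bool)
    (p : H -> R) (S : {set H}) (h : H) :
    (forall (c : company) (S T : {set H}), T \subset S -> (f c T <= f c S)%N) ->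
    (forall h : H, 0 <= p h <= 1) ->
  h \notin S -> Pi3 f p S <= Pi3 f p (h |: S).
Proof.
move=> f_incr p01 hNS; rewrite /Pi3 !indep_probE sent_ballotsU1.
rewrite {1}(sent_ballots_notin hNS); set C := [set b in _ | _].
have CNh o : (h, o) \notin C by rewrite !inE eqxx andbF.
(* Condition on the two separate ballots of [h] on the left and on the joint one on the right; both
   sides are then expectations over subsets [W] of [C]. *)
rewrite !indep_expectU1 //; last by rewrite !inE eqxx !andbF orbF xpair_eqE eqxx.
apply: ler_indep_expect => // W sWC /=.
have WNh o : ((h, o) \in W) = false.
  by apply/negbTE; apply: contra (CNh o); apply: (subsetP sWC).
(* [W] holds no ballot of [h], so [V c] omits [h]. A joint ballot adds [h] in both companies, a
   separate one only in its own. *)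
pose V := yes_voters S W.
have joint c : yes_voters (h |: S) ((h, None) |: W) c = h |: V c.
  apply/setP => k; rewrite !inE !xpair_eqE.
  by case: (eqVneq k h) => [->|] /=; rewrite ?eqxx.
have jointN c : yes_voters (h |: S) W c = V c.
  apply/setP => k; rewrite !inE.
  by case: (eqVneq k h) => [->|] //=; rewrite (negPf hNS) !WNh.
have separate c d (U : {set ballot H}) :
    yes_voters S ((h, Some d) |: U) c =
    if c == d then h |: yes_voters S U c else yes_voters S U c.
  apply/setP => k; rewrite !(fun_if (fun X : {set H} => k \in X)) !inE !xpair_eqE.
  by case: (eqVneq k h) => [->|]; rewrite /= ?(negPf hNS) //; case: c d => -[].
rewrite /merger !joint !jointN !separate /= -/V.
by apply: joint_ballot_gain => //; apply: f_incr; apply: subsetUr.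
Qed.

Lemma Pi3_subset (R : realType) (H : finType) (f : company -> {set H} -> bool)
    (p : H -> R) (S T : {set H}) :
    (forall (c : company) (S T : {set H}), T \subset S -> (f c T <= f c S)%N) ->
    (forall h : H, 0 <= p h <= 1) ->
  T \subset S -> Pi3 f p T <= Pi3 f p S.
Proof.
(* Induction on the number of individuals still to be moved from [S :\: T] into [T]. *)
move=> f_incr p01; have [n] := ubnP #|S :\: T|.
elim: n T => // n IHn T ltST sTS.
have [/eqP|[h hST]] := set_0Vmem (S :\: T).
  by rewrite setD_eq0 => sST; have /eqP -> : T == S by rewrite eqEsubset sTS.
have /setDP[hS hNT] := hST.
apply: le_trans (Pi3_setU1 f_incr p01 hNT) _; apply: IHn; last first.
  by rewrite subUset sub1set hS.
by move: ltST; rewrite (cardsD1 h) hST setDDl setUC.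
Qed.

Theorem proposition5 (R : realType) (H : finType)
    (f : company -> {set H} -> bool)
    (f_incr : forall (c : company) (S T : {set H}),
        T \subset S -> (f c T <= f c S)%N)
    (f_empty : forall c : company, f c set0 = false)
    (f_full : forall c : company, f c [set: H] = true)
    (p : H -> R) (p01 : forall h : H, 0 <= p h <= 1) :
  (forall S T : {set H}, T \subset S -> Pi3 f p T <= Pi3 f p S) /\
  (forall S : {set H}, Pi3 f p S <= Pi3 f p [set: H]).

Proof.
have mono (S T : {set H}) : T \subset S -> Pi3 f p T <= Pi3 f p S.
  exact: Pi3_subset.
by split=> [//|S]; apply: mono; apply: subsetT.
Qed.
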